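(* Let $d,k,n\ge 1$ be three integers. If there exists a regular map $$\mathsf{Shuffler}^{\circ n}(\mathbb{Z}^d)\longrightarrow \mathbb{Z}/2\mathbb{Z}\wr(\mathbb{Z}/2\mathbb{Z}\wr(\dots(\mathbb{Z}/2\mathbb{Z}\wr\mathbb{Z}^k))),$$ where the wreath product is iterated $n$ times, then $d<k$.
   Context: Lampshuffler: $\mathsf{Shuffler}(H)=\mathsf{FSym}(H)\rtimes H$, where $\mathsf{FSym}(H)$ is the group of finitely supported bijections $H\to H$ and $H$ acts by $(h\cdot\sigma)(x)=h\sigma(h^{-1}x)$. Iterates: $\mathsf{Shuffler}^{\circ 0}(H)=H$ and $\mathsf{Shuffler}^{\circ n}(H)=\mathsf{Shuffler}(\mathsf{Shuffler}^{\circ(n-1)}(H))$ for $n\ge 1$. $F\wr H=(\bigoplus_H F)\rtimes H$. The iterated wreath product is $W_n$, where $W_0=\mathbb{Z}^k$ and $W_{i}=\mathbb{Z}/2\mathbb{Z}\wr W_{i-1}$. Finitely generated groups are endowed with word metrics associated to finite generating sets. A map $f\colon X\to Y$ between metric spaces is regular if it is $C$-Lipschitz for some $C>0$ and there is $m\ge 1$ such that $|f^{-1}(\{y\})|\le m$ for all $y\in Y$. *)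

(* Defs.v *)
From HB Require Import structures.
From mathcomp Require Import all_boot all_order all_algebra.
From mathcomp Require Import finmap.
From mathcomp Require Import all_classical all_reals.
From mathcomp Require Import topology.

Set Implicit Arguments.
Unset Strict Implicit.
Unset Printing Implicit Defensive.

Import Order.TTheory GRing.Theory Num.Theory.

Local Open Scope classical_set_scope.
Local Open Scope fset_scope.
Local Open Scope group_scope.

(* Left actions of [H] on [N] by automorphisms; the actions of
   [mathcomp.fingroup.action] are right actions of finite groups. *)
Record autAction (H N : groupType) := AutAction {
  aact :> H -> N -> N;
  aact1 : forall x, aact 1 x = x;
  aactM : forall g h x, aact (g * h) x = aact g (aact h x);
  aact_morph : forall h, {morph aact h : x y / x * y}
}.

Definition semidirect (H N : groupType) (a : autAction H N) : Type :=
  (N * H)%type.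

Section SemidirectProduct.
Context (H N : groupType) (a : autAction H N).
Local Notation sdp := (semidirect a).
HB.instance Definition _ := Choice.copy sdp (N * H)%type.

Implicit Types p q r : sdp.

Definition sdp_one : sdp := (1, 1).
Definition sdp_mul p q : sdp := (p.1 * a p.2 q.1, p.2 * q.2).
Definition sdp_inv p : sdp := (a p.2^-1 p.1^-1, p.2^-1).

Lemma aact_g1 h : a h 1 = 1.
Proof. by apply: (mulgI (a h 1)); rewrite -aact_morph !mulg1. Qed.

Lemma sdp_mulA : associative sdp_mul.
Proof.
by move=> p q r; rewrite /sdp_mul /= aact_morph aactM !mulgA.
Qed.

Lemma sdp_mul1 : left_id sdp_one sdp_mul.
Proof. by move=> [x g]; rewrite /sdp_mul /= aact1 !mul1g. Qed.

Lemma sdp_mulr1 : right_id sdp_one sdp_mul.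
Proof. by move=> [x g]; rewrite /sdp_mul /= aact_g1 !mulg1. Qed.

Lemma sdp_mulV : left_inverse sdp_one sdp_inv sdp_mul.
Proof. by move=> [x g]; rewrite /sdp_mul /= -aact_morph !mulVg aact_g1. Qed.

Lemma sdp_mulrV : right_inverse sdp_one sdp_inv sdp_mul.
Proof.
by move=> [x g]; rewrite /sdp_mul /= -aactM mulgV aact1 !mulgV.
Qed.

HB.instance Definition _ :=
  isGroup.Build sdp sdp_mulA sdp_mul1 sdp_mulr1 sdp_mulV sdp_mulrV.
End SemidirectProduct.

Section DirectSum.
Context (H : choiceType) (F : groupType).

Definition dirsum : Type := {fsfun H -> F with 1}.
HB.instance Definition _ := Choice.copy dirsum {fsfun H -> F with 1}.

Implicit Types f g : dirsum.

Definition dirsum_one : dirsum := [fsfun with 1].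
Definition dirsum_mul f g : dirsum :=
  [fsfun x in finsupp f `|` finsupp g => f x * g x].
Definition dirsum_inv f : dirsum := [fsfun x in finsupp f => (f x)^-1].

Lemma dirsum_oneE x : dirsum_one x = 1.
Proof. by rewrite fsfunE. Qed.

Lemma dirsum_mulE f g x : dirsum_mul f g x = f x * g x.
Proof.
rewrite fsfunE inE; case: (finsuppP f) => //= _.
by case: (finsuppP g) => //= _; rewrite mulg1.
Qed.

Lemma dirsum_invE f x : dirsum_inv f x = (f x)^-1.
Proof. by rewrite fsfunE; case: (finsuppP f) => //; rewrite invg1. Qed.

Lemma dirsum_mulA : associative dirsum_mul.
Proof. by move=> f g h; apply/fsfunP => x; rewrite !dirsum_mulE mulgA. Qed.

Lemma dirsum_mul1 : left_id dirsum_one dirsum_mul.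
Proof.
by move=> f; apply/fsfunP => x; rewrite dirsum_mulE dirsum_oneE mul1g.
Qed.

Lemma dirsum_mulr1 : right_id dirsum_one dirsum_mul.
Proof.
by move=> f; apply/fsfunP => x; rewrite dirsum_mulE dirsum_oneE mulg1.
Qed.

Lemma dirsum_mulV : left_inverse dirsum_one dirsum_inv dirsum_mul.
Proof.
move=> f; apply/fsfunP => x.
by rewrite dirsum_mulE dirsum_invE dirsum_oneE mulVg.
Qed.

Lemma dirsum_mulrV : right_inverse dirsum_one dirsum_inv dirsum_mul.
Proof.
move=> f; apply/fsfunP => x.
by rewrite dirsum_mulE dirsum_invE dirsum_oneE mulgV.
Qed.

HB.instance Definition _ := isGroup.Build dirsum
  dirsum_mulA dirsum_mul1 dirsum_mulr1 dirsum_mulV dirsum_mulrV.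
End DirectSum.

Section Wreath.
Context (F H : groupType).

Definition lamp_shift (h : H) (f : dirsum H F) : dirsum H F :=
  [fsfun x in [fset h * y | y in finsupp f] => f (h^-1 * x)].

Lemma lamp_shiftE h f x : lamp_shift h f x = f (h^-1 * x).
Proof.
rewrite fsfunE; case: ifP => // /negP hx.
case: (finsuppP f) => // hf; case: hx.
by apply/imfsetP; exists (h^-1 * x) => //; rewrite mulVKg.
Qed.

Lemma lamp_shift1 f : lamp_shift 1 f = f.
Proof. by apply/fsfunP => x; rewrite lamp_shiftE invg1 mul1g. Qed.

Lemma lamp_shiftM g h f : lamp_shift (g * h) f = lamp_shift g (lamp_shift h f).
Proof. by apply/fsfunP => x; rewrite !lamp_shiftE invgM mulgA. Qed.

Lemma lamp_shift_morph h : {morph lamp_shift h : f g / f * g}.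
Proof. by move=> f g; apply/fsfunP => x; rewrite !(lamp_shiftE, dirsum_mulE). Qed.

Definition lamp_shift_action : autAction H (dirsum H F) :=
  AutAction lamp_shift1 lamp_shiftM lamp_shift_morph.

Definition wreath : groupType := semidirect lamp_shift_action.
End Wreath.

Section FinSym.
Context (T : choiceType).

(* [{fsfun T -> T}] is the type of the maps [T -> T] equal to the identity
   outside a finite set. *)
Record finsym := FinSym {
  finsym_fun :> {fsfun T -> T};
  finsym_bijb : `[< bijective finsym_fun >]
}.
HB.instance Definition _ := [isSub for finsym_fun].
HB.instance Definition _ := [Choice of finsym by <:].

Implicit Types s t u : finsym.

Lemma finsym_bij s : bijective s.
Proof. exact/asboolP/finsym_bijb. Qed.

Lemma finsymP s t : s =1 t <-> s = t.
Proof. by split=> [st|->//]; apply/val_inj/fsfunP. Qed.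

Lemma finsym_one_subproof : `[< bijective ([fsfun] : {fsfun T -> T}) >].
Proof.
by apply/asboolP; exists id => x; rewrite fsfunE.
Qed.
Definition finsym_one : finsym := FinSym finsym_one_subproof.

Lemma finsym_mul_subproof s t :
  `[< bijective (fsfun_comp (finsym_fun s) (finsym_fun t)) >].
Proof.
apply/asboolP; apply: (eq_bij (bij_comp (finsym_bij s) (finsym_bij t))) => x.
by rewrite fscompE.
Qed.
Definition finsym_mul s t : finsym := FinSym (finsym_mul_subproof s t).

Lemma finsym_inv_ex s : exists t, cancel s t /\ cancel t s.
Proof.
have [g sK gK] := finsym_bij s.
pose f : {fsfun T -> T} := [fsfun y in finsupp s => g y].
have fE y : f y = g y.
  rewrite fsfunE; case: ifP => // /negP hy.
  by case: (finsuppP s y) (sK y) hy => // _ {1}<-.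
have fbij : `[< bijective f >].
  by apply/asboolP; exists s => x; rewrite fE ?gK ?sK.
by exists (FinSym fbij); split=> x /=; rewrite fE.
Qed.
Definition finsym_inv s : finsym := projT1 (cid (finsym_inv_ex s)).

Lemma finsym_oneE x : finsym_one x = x.
Proof. by rewrite fsfunE. Qed.

Lemma finsym_mulE s t x : finsym_mul s t x = s (t x).
Proof. by rewrite fscompE. Qed.

Lemma finsymK s : cancel s (finsym_inv s).
Proof. by rewrite /finsym_inv; case: cid => t []. Qed.

Lemma finsymVK s : cancel (finsym_inv s) s.
Proof. by rewrite /finsym_inv; case: cid => t []. Qed.

Lemma finsym_mulA : associative finsym_mul.
Proof. by move=> s t u; apply/finsymP => x; rewrite !finsym_mulE. Qed.

Lemma finsym_mul1 : left_id finsym_one finsym_mul.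
Proof. by move=> s; apply/finsymP => x; rewrite finsym_mulE finsym_oneE. Qed.

Lemma finsym_mulr1 : right_id finsym_one finsym_mul.
Proof. by move=> s; apply/finsymP => x; rewrite finsym_mulE finsym_oneE. Qed.

Lemma finsym_mulV : left_inverse finsym_one finsym_inv finsym_mul.
Proof. by move=> s; apply/finsymP => x; rewrite finsym_mulE finsym_oneE finsymK. Qed.

Lemma finsym_mulrV : right_inverse finsym_one finsym_inv finsym_mul.
Proof. by move=> s; apply/finsymP => x; rewrite finsym_mulE finsym_oneE finsymVK. Qed.

HB.instance Definition _ := isGroup.Build finsym
  finsym_mulA finsym_mul1 finsym_mulr1 finsym_mulV finsym_mulrV.
End FinSym.

Section Shuffler.
Context (H : groupType).

Definition perm_shift_fun (h : H) (s : finsym H) : {fsfun H -> H} :=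
  [fsfun x in [fset h * y | y in finsupp s] => h * s (h^-1 * x)].

Lemma perm_shift_funE h s x : perm_shift_fun h s x = h * s (h^-1 * x).
Proof.
rewrite fsfunE; case: ifP => // /negP hx.
case: (finsuppP s) => [_|hs]; first by rewrite mulVKg.
by case: hx; apply/imfsetP; exists (h^-1 * x) => //; rewrite mulVKg.
Qed.

Lemma perm_shift_subproof h s : `[< bijective (perm_shift_fun h s) >].
Proof.
apply/asboolP; exists (fun x => h * (s^-1 : finsym H) (h^-1 * x)) => x;
  by rewrite perm_shift_funE mulKg ?finsymK ?finsymVK mulVKg.
Qed.
Definition perm_shift h s : finsym H := FinSym (perm_shift_subproof h s).

Lemma perm_shiftE h s x : perm_shift h s x = h * s (h^-1 * x).
Proof. exact: perm_shift_funE. Qed.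

Lemma perm_shift1 s : perm_shift 1 s = s.
Proof. by apply/finsymP => x; rewrite perm_shiftE invg1 !mul1g. Qed.

Lemma perm_shiftM g h s : perm_shift (g * h) s = perm_shift g (perm_shift h s).
Proof. by apply/finsymP => x; rewrite !perm_shiftE invgM !mulgA. Qed.

Lemma perm_shift_morph h : {morph perm_shift h : s t / s * t}.
Proof.
by move=> s t; apply/finsymP => x; rewrite !(perm_shiftE, finsym_mulE) mulKg.
Qed.

Definition perm_shift_action : autAction H (finsym H) :=
  AutAction perm_shift1 perm_shiftM perm_shift_morph.

Definition Shuffler : groupType := semidirect perm_shift_action.
End Shuffler.

Definition iterShuffler (n : nat) (H : groupType) : groupType :=
  iter n Shuffler H.

(* [Algebra.to_multiplicative V] is the additive group of [V], written
   multiplicatively. *)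
Definition Zpow (d : nat) : groupType := Algebra.to_multiplicative 'rV[int]_d.
Definition Zmod2 : groupType := Algebra.to_multiplicative 'Z_2.

Definition iterWreath (n k : nat) : groupType := iter n (wreath Zmod2) (Zpow k).

Section WordMetric.
Context (G : groupType).

Definition is_word (A : {fset G}) (w : seq G) : bool :=
  all (fun x => (x \in A) || (x^-1 \in A)) w.

Record fgenset := FGenset {
  gens :> {fset G};
  gensP : forall g : G, exists2 w, is_word gens w & \prod_(x <- w) x = g
}.

Context (S : fgenset).

Definition has_word (g : G) (n : nat) : Prop :=
  exists w, [/\ is_word S w, size w = n & \prod_(x <- w) x = g].

Lemma has_word_ex g : exists n, `[< has_word g n >].
Proof.
by have [w wS wg] := gensP S g; exists (size w); apply/asboolP; exists w.
Qed.

Definition word_length (g : G) : nat := ex_minn (has_word_ex g).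

Lemma word_length_word g : has_word g (word_length g).
Proof. by rewrite /word_length; case: ex_minnP => n /asboolP. Qed.

Lemma word_length_min g n : has_word g n -> (word_length g <= n)%N.
Proof.
by move=> gn; rewrite /word_length; case: ex_minnP => m _; apply; apply/asboolP.
Qed.

Lemma word_length1 : word_length 1 = 0%N.
Proof.
apply/eqP; rewrite -leqn0; apply: word_length_min.
by exists [::]; rewrite big_nil.
Qed.

Lemma word_length0 g : word_length g = 0%N -> g = 1.
Proof.
move=> g0; have := word_length_word g; rewrite g0 => -[w [_ /size0nil -> <-]].
by rewrite big_nil.
Qed.

Lemma word_lengthM g h : (word_length (g * h) <= word_length g + word_length h)%N.
Proof.
have [v [vS <- vg]] := word_length_word g.
have [w [wS <- wh]] := word_length_word h.
apply: word_length_min; exists (v ++ w).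
by rewrite /is_word all_cat size_cat big_cat vg wh; split=> //; apply/andP.
Qed.

Lemma word_lengthV_le g : (word_length g^-1 <= word_length g)%N.
Proof.
have [w [wS <- <-]] := word_length_word g.
apply: word_length_min; exists (rev [seq x^-1 | x <- w]).
split; last 1 first.
- elim: w {wS} => [|x w IH]; first by rewrite !big_nil invg1.
  by rewrite map_cons rev_cons -cats1 big_cat IH big_seq1 big_cons invgM.
- rewrite /is_word all_rev all_map; apply: sub_all wS => x /=.
  by rewrite invgK orbC.
- by rewrite size_rev size_map.
Qed.

Lemma word_lengthV g : word_length g^-1 = word_length g.
Proof.
apply/eqP; rewrite eqn_leq word_lengthV_le /=.
by rewrite -{1}[g]invgK word_lengthV_le.
Qed.
End WordMetric.

(* The metric space [(G, d_S)], [d_S g h] being the [S]-length of [g^-1 h]. *)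
Definition wordSpace (R : realType) (G : groupType) (S : fgenset G) : Type := G.

Section WordSpace.
Context (R : realType) (G : groupType) (S : fgenset G).
Local Notation X := (wordSpace R S).
HB.instance Definition _ := Choice.copy X G.

Definition word_dist (g h : X) : R :=
  (word_length S ((g : G)^-1 * (h : G)))%:R%R.

Lemma word_distxx g : word_dist g g = 0%R.
Proof. by rewrite /word_dist mulVg word_length1. Qed.

Lemma word_dist_pos g h : word_dist g h = 0%R -> g = h.
Proof.
move=> /eqP; rewrite /word_dist pnatr_eq0 => /eqP /word_length0 gh.
by rewrite -[LHS]mulg1 -gh mulVKg.
Qed.

Lemma word_distC g h : word_dist g h = word_dist h g.
Proof. by rewrite /word_dist -word_lengthV invgM invgK. Qed.

Lemma word_dist_triangle h g k :
  (word_dist g k <= word_dist g h + word_dist h k)%R.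
Proof.
rewrite /word_dist -natrD ler_nat.
by rewrite -[X in word_length S X](_ : g^-1 * h * (h^-1 * k) = _) ?word_lengthM //
  -mulgA mulVKg.
Qed.

HB.instance Definition _ := @isMetric.Build R X word_dist
  word_distxx word_dist_pos word_distC word_dist_triangle.
End WordSpace.

Definition lipschitz_map (R : realType) (X Y : metricType R) (C : R)
    (f : X -> Y) : Prop :=
  forall x y, (mdist (f x) (f y) <= C * mdist x y)%R.

Definition regular_map (R : realType) (X Y : metricType R) (f : X -> Y) : Prop :=
  (exists2 C : R, (0 < C)%R & lipschitz_map C f) /\
  (exists2 m : nat, (1 <= m)%N &
     forall y : Y, ([set x | f x = y]%classic #<= `I_m)%card).

(* Main.v *)
Require Import Defs.
From mathcomp Require Import all_boot all_order all_algebra.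
From mathcomp Require Import finmap.
From mathcomp Require Import all_classical all_reals.
From mathcomp Require Import topology.
From mathcomp Require Import zify.

(** The proof compares Følner functions. Let [leak A s] be the number of [a] in
    [A] such that [a s] is not in [A]; the smaller the ratios [leak A s / |A|],
    the larger [A] has to be.

    - A regular map [f] from an amenable group [X] to [Y] pulls Følner sets back:
      for a finite [B] in [Y], averaging the sets [{x in F | y f(x) in B}] over
      [y], with [F] an almost invariant subset of [X], gives a subset of [X] which
      is about as invariant as [B] and has at most [m |B|] elements.
    - If [F] is a Følner set of [H], adding the lamp configurations supported near
      [F] gives one of [Z/2 wr H], with [exp(O(|F|))] elements.
    - If the sets of invariance [r] in [H] have at least [N] elements, those of
      [Shuffler H] have at least [2^(c N)]: after pruning, a Følner set of
      [Shuffler H] gives a finite set of permutations of which each element can be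
      multiplied, inside the set, by [N / 8] transpositions of the form
      [(h, h x)].
    - In [Shuffler Z^d], all the transpositions [(x, x + j e)] with [x] in a box of
      side [rho] and [j <= rho] have length [O(rho)], so each permutation has
      [rho^d] points that can be moved to [rho] places. This gives the lower bound
      [rho^(c rho^d)], which beats the upper bound [exp(O(rho^k))] in [Z/2 wr Z^k]
      as soon as [k <= d]; iterating preserves the gap. *)

Set Implicit Arguments.
Unset Strict Implicit.
Unset Printing Implicit Defensive.

Import Order.TTheory GRing.Theory Num.Theory.

Local Open Scope fset_scope.
Local Open Scope group_scope.

(** * Counting in finite sets *)

Lemma count_inj_leq (T U : choiceType) (A : {fset T}) (B : {fset U})
    (P : pred T) (Q : pred U) (g : T -> U) :
    {in [pred x | (x \in A) && P x] &, injective g} ->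
    (forall x, x \in A -> P x -> (g x \in B) && Q (g x)) ->
  (count P A <= count Q B)%N.
Proof.
move=> g_inj gAB; rewrite -!size_filter -(size_map g).
apply: uniq_leq_size => [|_ /mapP[x + ->]].
  rewrite map_inj_in_uniq ?filter_uniq // => x y.
  by rewrite !mem_filter ![_ && (_ \in _)]andbC => xA yA; apply: g_inj.
by rewrite !mem_filter andbC => /andP[xA Px]; rewrite andbC gAB.
Qed.

Lemma count_fset_filter (T : choiceType) (A : {fset T}) (Q P : pred T) :
  count P [fset x in A | Q x] = count (fun x => Q x && P x) A.
Proof.
rewrite -!size_filter; apply/perm_size/uniq_perm; rewrite ?filter_uniq //.
by move=> x; rewrite !mem_filter !inE /=; case: (x \in A); rewrite ?andbF ?andbT // andbC.
Qed.

Lemma count_pair_swap (T U : choiceType) (A : seq T) (B : seq U)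
    (P : T -> U -> bool) :
  \sum_(x <- A) count (P x) B = \sum_(y <- B) count (P^~ y) A :> nat.
Proof.
under eq_bigr do rewrite -sum1_count big_mkcond.
rewrite exchange_big /=; apply: eq_bigr => y _.
by rewrite -sum1_count [RHS]big_mkcond.
Qed.

Lemma count_fibers (T V : choiceType) (A : {fset T}) (p : T -> V) (P : pred T) :
  count P A = \sum_(v <- p @` A) count (fun a => P a && (p a == v)) A :> nat.
Proof.
rewrite count_pair_swap -sum1_count big_mkcond big_seq [RHS]big_seq.
apply: eq_bigr => a aA; case: (P a) => /=; last by rewrite count_pred0.
rewrite (eq_count (a2 := pred1 (p a))) => [|v]; last by rewrite /= eq_sym.
by rewrite count_uniq_mem ?fset_uniq// in_imfset.
Qed.

Lemma count_sum_leq (T : Type) (I : Type) (r : seq I) (P : pred T)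
    (Q : I -> pred T) (A : seq T) :
    (forall a, P a -> has (Q^~ a) r) ->
  (count P A <= \sum_(i <- r) count (Q i) A)%N.
Proof.
move=> PQ; elim: A => [|a A IH] /=; first by [].
rewrite (eq_bigr (fun i => (Q i a + count (Q i) A)%N)) // big_split /= leq_add //.
case: (boolP (P a)) => //= /PQ; elim: r {PQ IH} => //= i r IH.
by rewrite big_cons => /orP[->|/IH H] //; lia.
Qed.

Lemma count_leqD (T : eqType) (P Q R : pred T) (A : seq T) :
    {in A, forall a, P a -> Q a || R a} ->
  (count P A <= count Q A + count R A)%N.
Proof.
elim: A => //= a A IH PQR; have := PQR a (mem_head _ _).
have /IH : {in A, forall a, P a -> Q a || R a}.
  by move=> x xA; apply: PQR; rewrite inE xA orbT.
by case: (P a) (Q a) (R a) => [] [] [] //=; lia.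
Qed.

(** * Leaks as a length function *)

Section Leak.
Context (G : groupType).
Implicit Types (A : {fset G}) (s t : G).

Definition leak A s : nat := count (fun a => a * s \notin A) A.

Lemma leak1 A : leak A 1 = 0%N.
Proof.
by apply/eqP; rewrite -leqn0 leqNgt -has_count; apply/hasPn => a; rewrite mulg1 negbK.
Qed.

(** A point that stays under [s] but leaves under [s * t] is carried by [s] to a point of [A] that
    leaves under [t]. With [leakV], this makes [leak A] behave like a length: it is controlled by
    its values on generators. *)
Lemma leakM A s t : (leak A (s * t) <= leak A s + leak A t)%N.
Proof.
apply: (@leq_trans (leak A s + count (fun a => (a * s \in A) && (a * (s * t) \notin A)) A)).
  by apply: count_leqD => a _ ->; rewrite andbT orNb.
rewrite leq_add2l; apply: (@count_inj_leq _ _ _ _ _ _ (fun a => a * s)).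
  by move=> x y _ _ /mulIg.
by move=> x xA /andP[? ?]; apply/andP; rewrite -mulgA.
Qed.

Lemma leakV A s : (leak A s^-1 <= leak A s)%N.
Proof.
have E u : leak A u = (#|` A| - count (fun a => (a * u)%g \in A) A)%N.
  by rewrite -(count_predC (fun a => (a * u)%g \in A) A) addKn.
rewrite !E leq_sub2l //; apply: (@count_inj_leq _ _ _ _ _ _ (fun a => a * s)).
  by move=> x y _ _ /mulIg.
by move=> x xA ->; rewrite mulgK.
Qed.

Lemma leakJ A s t : (leak A (t * s * t^-1) <= leak A s + 2 * leak A t)%N.
Proof.
apply: (leq_trans (leakM _ _ _)); have := leakV A t; have := leakM A t s; lia.
Qed.

Lemma count_stay A s : count (fun a => a * s \in A) A = (#|` A| - leak A s)%N.
Proof.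
by rewrite -(count_predC (fun a => (a * s \in A)) A) addnK.
Qed.
End Leak.
Arguments leak {G}.

(* The removal of the fibers of too small degree cannot decrease the edge
   density, so it stops before exhausting [A]. *)
Lemma prune_fibers (T V : choiceType) (i : T -> T) (p : T -> V) (A : {fset T})
    (c : nat) :
    involutive i -> A != fset0 ->
    (#|` A| <= c * count (fun a => i a \in A) A)%N ->
  exists P : {fset V}, [/\ P != fset0, P `<=` p @` A &
    forall v, v \in P -> (count (fun a => p a == v) A <=
      2 * c * count (fun a => [&& p a == v, i a \in A & p (i a) \in P]) A)%N].
Proof.
move=> iK An0 Ac.
(* The edges join [a] to [i a]; [e P] counts those with both ends over [P], once from each end. The
   invariant bounds the number of elements over [P] by [c] times this count. *)
pose e (P : {fset V}) a := [&& p a \in P, i a \in A & p (i a) \in P].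
suff: forall n (P : {fset V}), (#|` P| <= n)%N -> P != fset0 -> P `<=` p @` A ->
   (count (fun a => p a \in P) A <= c * count (e P) A)%N ->
   exists P : {fset V}, [/\ P != fset0, P `<=` p @` A &
    forall v, v \in P -> (count (fun a => p a == v) A <=
      2 * c * count (fun a => [&& p a == v, i a \in A & p (i a) \in P]) A)%N].
  move=> /(_ _ (p @` A) (leqnn _)); apply=> //.
    case/fset0Pn: An0 => a aA; apply/fset0Pn; exists (p a).
    by rewrite in_imfset.
  rewrite (@eq_in_count _ _ predT) => [|a aA]; last by rewrite in_imfset.
  rewrite count_predT; apply: (leq_trans Ac); rewrite leq_mul2l.
  apply/orP; right; rewrite leq_eqVlt; apply/orP; left; apply/eqP.
  apply: eq_in_count => a aA; rewrite /e in_imfset //=.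
  by case: (boolP (i a \in A)) => // iaA; rewrite in_imfset.
elim=> [|n IH] P Pn Pn0 PA Pe.
  by move: Pn; rewrite leqn0 cardfs_eq0 (negPf Pn0).
have [/allP good|/allPn[v vP]] := boolP (all (fun v => (count (fun a => p a == v) A <=
      2 * c * count (fun a => [&& p a == v, i a \in A & p (i a) \in P]) A)%N) P).
  by exists P.
rewrite -ltnNge; set d := count _ A => vbad.
have cP : (count (fun a => p a \in P) A =
     count (fun a => p a \in P `\ v) A + count (fun a => p a == v) A)%N.
  rewrite -count_predUI [X in (_ = _ + X)%N](_ : _ = 0%N) ?addn0; last first.
    rewrite -(count_pred0 A); apply: eq_count => a /=.
    by rewrite !inE; case: (p a == v); rewrite ?andbF.
  by apply: eq_count => a /=; rewrite !inE; case: eqVneq => [->|_] /=; rewrite ?vP ?orbF.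
(* The lost edges start or end over [v]; [i] exchanges the two kinds, so each has at most [d]
   elements. *)
have eP : (count (e P) A <= count (e (P `\ v)) A + 2 * d)%N.
  have d2 : (count (fun a => [&& p (i a) == v, i a \in A & p a \in P]) A <= d)%N.
    apply: (@count_inj_leq _ _ _ _ _ _ i); first by move=> x y _ _ /(can_inj iK).
    by move=> x xA /and3P[pv iA pP]; rewrite iK xA pv iA pP.
  rewrite mul2n -addnn; apply: leq_trans (leq_add (leqnn _) (leq_add (leqnn d) d2)).
  apply: (@leq_trans (count (e (P `\ v)) A + count (predU
      (fun a => [&& p a == v, i a \in A & p (i a) \in P])
      (fun a => [&& p (i a) == v, i a \in A & p a \in P])) A)%N).
    apply: count_leqD => a _ /and3P[aP iaA iaP].
    by rewrite /e !inE aP iaA iaP !andbT; case: (p a == v); case: (p (i a) == v).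
  by rewrite leq_add2l; apply: count_leqD.
have lt : (count (fun a => p a \in P `\ v) A < c * count (e (P `\ v)) A)%N.
  have : (c * count (e P) A <= c * (count (e (P `\ v)) A + 2 * d))%N.
    by rewrite leq_mul2l eP orbT.
  by rewrite mulnDr; lia.
apply: (IH (P `\ v)).
- by move: Pn; rewrite (cardfsD1 v) vP.
(* Over an empty set there is no edge, which the strict inequality excludes. *)
- apply: contraTneq lt => P0; rewrite -leqNgt.
  by rewrite [X in (c * X)%N](_ : _ = 0%N) ?muln0 // -(count_pred0 A);
    apply: eq_count => a; rewrite /e P0 !inE.
- by apply: fsubset_trans PA; apply: fsubD1set.
- exact: ltnW.
Qed.

(** A tree of depth [n]: the elements agreeing with [g] on [Z] split according to their value at a
    further point [a], and at least [q] values occur. The points of [Z] are those already used on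
    the branch. *)
Lemma branching_card (G X Y : choiceType) (P : {fset G}) (f : G -> X -> Y)
    (q n : nat) :
    (forall (Z : {fset X}) g, (#|` Z| < n)%N -> g \in P ->
      exists a, exists2 W : {fset Y}, (q <= #|` W|)%N &
        forall v, v \in W -> exists2 g', g' \in P &
          f g' a = v /\ {in Z, f g' =1 f g}) ->
  forall g, g \in P -> (q ^ n <= #|` P|)%N.
Proof.
move=> branch.
suff H m (Z : {fset X}) g : (#|` Z| + m <= n)%N -> g \in P ->
    (q ^ m <= count (fun g' => all (fun z => f g' z == f g z) Z) P)%N.
  move=> g gP; apply: leq_trans (H n fset0 g _ gP) _; first by rewrite cardfs0.
  exact: count_size.
elim: m Z g => [|m IH] Z g Zn gP.
  by rewrite expn0 -has_count; apply/hasP; exists g => //; apply/allP.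
have [|a [W qW WP]] := branch Z g _ gP; first by lia.
rewrite expnS; apply: (@leq_trans (\sum_(v <- W) q ^ m)).
  by rewrite big_const_seq count_predT iter_addn_0 mulnC leq_mul2l qW orbT.
apply: (@leq_trans (\sum_(v <- W) count (fun g' => 
    all (fun z => f g' z == f g z) Z && (f g' a == v)) P)).
  rewrite big_seq [leqRHS]big_seq; apply: leq_sum => v /WP[g' g'P [g'a g'Z]].
  have : (#|` a |` Z| + m <= n)%N by rewrite cardfsU1; lia.
  move=> /(IH _ g')/(_ g'P)/leq_trans; apply; apply: sub_count => h /allP hZ /=.
  apply/andP; split; last by rewrite -g'a; apply: hZ; rewrite !inE eqxx.
  by apply/allP => z zZ; rewrite -(g'Z z zZ); apply: hZ; rewrite !inE zZ orbT.
rewrite count_pair_swap -sum1_count [leqRHS]big_mkcond /=; apply: leq_sum => h _.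
case: all => /=; last by rewrite count_pred0.
rewrite (eq_count (a2 := pred1 (f h a))) => [|v]; last by rewrite /= eq_sym.
by rewrite count_uniq_mem ?fset_uniq ?leq_b1.
Qed.

(** * Følner sets and regular maps *)

Definition amenable (G : groupType) : Prop :=
  forall (S : {fset G}) (r : nat), exists2 F : {fset G}, F != fset0 &
    {in S, forall s, (r * leak F s <= #|` F|)%N}.

(* The Følner function of [Y] is negligible with respect to that of [X], even after
   a dilation by [C]. Only [r] and [B] depend on [T]: the choice of [S] first is
   what allows [T] to be the set of displacements of a map from [X] to [Y]. *)
Definition folner_dominates (X Y : groupType) : Prop :=
  exists S : {fset X}, forall (T : {fset Y}) (K C : nat),
  exists r, exists B : {fset Y}, [/\ (K <= r)%N, B != fset0,
    {in T, forall t, (r * leak B t <= #|` B|)%N} &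
    forall A : {fset X}, A != fset0 ->
      {in S, forall s, (r * leak A s <= C * #|` A|)%N} ->
    (K * #|` B| <= #|` A|)%N].

Lemma sum_nat_fset_const (T : choiceType) (A : {fset T}) n :
  \sum_(x <- A) n = (#|` A| * n)%N.
Proof. by rewrite big_const_seq count_predT iter_addn_0 mulnC. Qed.

Lemma sum_leq_ex (I : eqType) (r : seq I) (g a : I -> nat) c :
    (0 < \sum_(i <- r) a i)%N -> (\sum_(i <- r) g i <= c * \sum_(i <- r) a i)%N ->
  exists i, [/\ i \in r, (0 < a i)%N & (g i <= c * a i)%N].
Proof.
move=> a0 ga; apply: contrapT => none.
(* The boolean summand gives a strict inequality when the sum of [a] is positive, and still allows
   the induction to start from the empty list. *)
suff: (c * (\sum_(i <- r) a i) + (0 < \sum_(i <- r) a i) <= \sum_(i <- r) g i)%N.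
  by rewrite a0; lia.
have {a0 ga} : {in r, forall i, (0 < a i -> c * a i < g i)%N}.
  by move=> i ir ai; rewrite ltnNge; apply/negP => gi; apply: none; exists i.
elim: r {none} => [|i r IH] H; first by rewrite !big_nil; lia.
have /IH : {in r, forall i, (0 < a i -> c * a i < g i)%N}.
  by move=> j jr; apply: H; rewrite inE jr orbT.
have := H i (mem_head _ _); rewrite !big_cons.
case: (posnP (a i)) => [->|ai /(_ isT)]; first by rewrite add0n; lia.
by rewrite addn_gt0 ai; lia.
Qed.

(* The translates [y f] pull [B] back to subsets [A y] of [F]; each of them has
   at most [m |B|] elements, and on average they are as invariant as [B]. *)
Lemma folner_dominates_no_regular (X Y : groupType) (f : X -> Y) (m : nat) :
    amenable X -> folner_dominates X Y ->
    (forall S : {fset X}, exists T : {fset Y},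
      forall x s, s \in S -> (f x)^-1 * f (x * s) \in T) ->
    (forall y (A : {fset X}), count (fun x => f x == y) A <= m)%N ->
  False.
Proof.
move=> amX [S dom] lip fib.
have [T ST] := lip S.
(* The factor [m.+1] will contradict [#|A y| <= m * #|B|]. Each [s] leaks at most [2 / r] on
   average, and summing over [S] gives one [y] that suits all [s], hence [2 * #|S|]. *)
have [r [B [Kr B0 BT BA]]] := dom T m.+1 (2 * #|` S|)%N.
have [F F0 FS] := amX S r.
pose Ys : {fset Y} := [fset b * (f x)^-1 | b in B, x in F].
pose A y := [fset x in F | y * f x \in B].
have cA y P : count P (A y) = count (fun x => (y * f x \in B) && P x) F.
  exact: count_fset_filter.
(* [Ys] contains every [y] whose [A y] is nonempty, so for a fixed [x] in [F] the products [y * f x]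
   lying in [B] run exactly once through [B]. *)
have cY x P : x \in F -> count (fun y => (y * f x \in B) && P (y * f x)) Ys = count P B.
  move=> xF; apply/eqP; rewrite eqn_leq; apply/andP; split.
    apply: (@count_inj_leq _ _ _ _ _ _ (fun y => y * f x)).
      by move=> y z _ _ /mulIg.
    by [].
  apply: (@count_inj_leq _ _ _ _ _ _ (fun b => b * (f x)^-1)).
    by move=> y z _ _ /mulIg.
  move=> b bB Pb; rewrite mulgVK bB Pb /= andbT; apply/imfset2P.
  by exists b => //; exists x.
have sA : \sum_(y <- Ys) #|` A y| = (#|` F| * #|` B|)%N.
  under eq_bigr do rewrite -count_predT cA.
  rewrite count_pair_swap -sum_nat_fset_const big_seq [RHS]big_seq.
  apply: eq_bigr => x xF; rewrite -[#|` B|]count_predT.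
  by rewrite -(cY x predT xF).
have sL s : s \in S -> (r * (\sum_(y <- Ys) leak (A y) s) <= 2 * (#|` F| * #|` B|))%N.
  move=> sS.
  have -> : \sum_(y <- Ys) leak (A y) s =
      \sum_(x <- F) count (fun y => ((y * f x)%g \in B) && ((x * s)%g \notin A y)) Ys.
    under eq_bigr do rewrite /leak cA.
    by rewrite count_pair_swap.
  (* A point [x] of [A y] leaks either because [x * s] leaves [F], or because [y * f x] leaves [B]
     under the displacement of [f], which belongs to [T]. *)
  apply: (@leq_trans (r * (leak F s * #|` B| +
      \sum_(x <- F) leak B ((f x)^-1 * f (x * s))%g))%N).
    rewrite leq_mul2l; apply/orP; right.
    have -> : (leak F s * #|` B|)%N = \sum_(x <- F) (((x * s)%g \notin F) * #|` B|)%N.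
      by rewrite -big_distrl /leak -sum1_count big_mkcond.
    rewrite -big_split /=.
    rewrite big_seq [leqRHS]big_seq; apply: leq_sum => x xF.
    case: (boolP (x * s \in F)) => [xsF|_] /=; last first.
      rewrite mul1n; apply: leq_trans (leq_addr _ _).
      rewrite -[#|` B|]count_predT -(cY x predT xF).
      by apply: sub_count => y /andP[-> _].
    rewrite mul0n add0n /leak -(cY x (fun b => b * ((f x)^-1 * f (x * s)) \notin B)) //.
    by apply: sub_count => y; rewrite !inE xsF /= -mulgA mulVKg.
  rewrite mulnDr mulnA mul2n -addnn leq_add ?leq_mul2r ?FS ?orbT //.
  rewrite big_distrr -sum_nat_fset_const; apply: leq_sum => x _.
  exact/BT/ST.
have [y [yY Ay0 Ay]] : exists y, [/\ y \in (Ys : seq Y), (0 < #|` A y|)%N &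
    (\sum_(s <- S) r * leak (A y) s <= 2 * #|` S| * #|` A y|)%N].
  apply: sum_leq_ex; first by rewrite sA muln_gt0 !cardfs_gt0 F0.
  rewrite exchange_big /= sA mulnAC [leqRHS]mulnC -(sum_nat_fset_const S).
  rewrite big_seq [leqRHS]big_seq; apply: leq_sum => s sS.
  by rewrite -big_distrr /= sL.
have := BA (A y); rewrite -cardfs_gt0 => /(_ Ay0)/(_ _)/wrap[].
  move=> s sS; apply: leq_trans Ay; rewrite (big_fsetD1 s) //=; exact: leq_addr.
apply/negP; rewrite -ltnNge mulSn.
have : (#|` A y| <= m * #|` B|)%N.
  rewrite -[#|` A y|]count_predT cA.
  apply: (@leq_trans (\sum_(b <- B) count (fun x => f x == (y^-1 * b)%g) F)%N).
    apply: count_sum_leq => x /andP[yB _]; apply/hasP; exists (y * f x) => //.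
    by rewrite mulKg.
  by rewrite mulnC -sum_nat_fset_const; apply: leq_sum.
by move: B0; rewrite -cardfs_gt0; lia.
Qed.

(** * Følner sets of semidirect products *)

Section SemidirectSets.
Context (H N : groupType) (a : autAction H N).
Implicit Types (K : {fset N}) (F : {fset H}).

Definition sdprod_fset K F : {fset semidirect a} :=
  [fset ((k, h) : semidirect a) | k in K, h in F].

Lemma in_sdprod_fset K F (p : semidirect a) :
  (p \in sdprod_fset K F) = (p.1 \in K) && (p.2 \in F).
Proof.
apply/imfset2P/andP => [[k kK [h hF ->]] //|[p1 p2]].
by exists p.1 => //; exists p.2 => //; case: p {p1 p2}.
Qed.

Lemma count_sdprod_fset K F (P : pred H) :
  count (fun p : semidirect a => P p.2) (sdprod_fset K F) = (#|` K| * count P F)%N.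
Proof.
rewrite -size_filter -[in RHS]size_filter.
rewrite -(size_allpairs (fun k h => (k, h) : semidirect a)); apply/perm_size/uniq_perm.
- by rewrite filter_uniq ?fset_uniq.
- by apply: allpairs_uniq; rewrite ?filter_uniq ?fset_uniq // => -[x y] [x' y'] _ _ [-> ->].
move=> p; rewrite mem_filter in_sdprod_fset; apply/and3P/allpairsP.
  by case=> Pp p1 p2; exists p; rewrite mem_filter Pp; case: p Pp p1 p2.
by case=> q [q1]; rewrite mem_filter => /andP[Pq q2] ->.
Qed.

Lemma card_sdprod_fset K F : #|` sdprod_fset K F| = (#|` K| * #|` F|)%N.
Proof. by rewrite -count_predT -[#|` F|]count_predT -count_sdprod_fset. Qed.

(** By hypothesis the component in [N] never leaves [K], so only the component in [H] can leak. *)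
Lemma leak_sdprod_fset K F (p : semidirect a) :
    (forall k h, k \in K -> h \in F -> k * a h p.1 \in K) ->
  (leak (sdprod_fset K F) p <= #|` K| * leak F p.2)%N.
Proof.
move=> KF; rewrite -count_sdprod_fset /leak.
have -> : count (fun q => q * p \notin sdprod_fset K F) (sdprod_fset K F) =
  count (fun q : semidirect a => q.2 * p.2 \notin F) (sdprod_fset K F); last by [].
apply: eq_in_count => q; rewrite !in_sdprod_fset => /andP[q1 q2].
by rewrite KF.
Qed.

Lemma folner_sdprod (S : {fset semidirect a}) r K F :
    {in [fset p.2 | p in S], forall h, (r * leak F h <= #|` F|)%N} ->
    (forall k h p, k \in K -> h \in F -> p \in S -> k * a h p.1 \in K) ->
  {in S, forall p, (r * leak (sdprod_fset K F) p <= #|` sdprod_fset K F|)%N}.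
Proof.
move=> FS KF p pS; rewrite card_sdprod_fset.
apply: (@leq_trans (#|` K| * (r * leak F p.2))).
  rewrite mulnCA leq_mul2l; apply/orP; right; apply: leak_sdprod_fset => k h kK hF.
  exact: KF.
by rewrite leq_mul2l FS ?orbT // in_imfset.
Qed.

Lemma sdprod_fset_neq0 K F : K != fset0 -> F != fset0 -> sdprod_fset K F != fset0.
Proof. by rewrite -!cardfs_gt0 card_sdprod_fset muln_gt0 => -> ->. Qed.
End SemidirectSets.

Lemma ex_finsym_supp (T : choiceType) (V : {fset T}) :
  exists K : {fset finsym T}, forall s, (s \in K) = (finsupp s `<=` V).
Proof.
(* Finiteness comes from restriction to [V], which determines a permutation supported in [V]. When
   [f] is not a permutation, [e f] is the identity. *)
pose e (f : {ffun V -> V}) : finsym T :=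
  xget (finsym_one T) [set s : finsym T | (finsupp s `<=` V)%fset /\
     forall x : V, s (val x) = val (f x)]%classic.
exists [fset s in [fset e f | f : {ffun V -> V}] | finsupp s `<=` V] => s.
rewrite !inE /=; case: (boolP (finsupp s `<=` V)) => sV; rewrite ?andbF // andbT.
have sVP (x : V) : s (val x) \in V.
  case: (finsuppP s) => [_|xs]; first exact: valP.
  apply: (fsubsetP sV); rewrite mem_finsupp; apply: contraTneq xs => sx.
  rewrite memNfinsupp; apply/eqP; exact: (bij_inj (finsym_bij s)).
apply/imfsetP; exists [ffun x => FSetSub (sVP x)] => //.
rewrite /e; case: xgetP => [t _ [tV tE]|/(_ s)]; last first.
  by case; split=> // x; rewrite ffunE.
apply/finsymP => x; case: (boolP (x \in V)) => xV.
  by have := tE (FSetSub xV); rewrite ffunE /= => ->.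
rewrite !fsfun_dflt //; apply: contra xV; exact: fsubsetP.
Qed.

Lemma amenable_Shuffler (H : groupType) : amenable H -> amenable (Shuffler H).
Proof.
move=> amH S r; have [F F0 FS] := amH [fset p.2 | p in S] r.
pose V := \bigcup_(p <- S) \bigcup_(h <- F) finsupp (perm_shift h p.1).
have [K KE] := ex_finsym_supp V.
exists (sdprod_fset (perm_shift_action H) K F).
  apply: sdprod_fset_neq0 => //; apply/fset0Pn; exists 1; rewrite KE.
  by apply/fsubsetP => x; rewrite mem_finsupp finsym_oneE eqxx.
apply: folner_sdprod => // k h p; rewrite !KE => kV hF pS.
apply/fsubsetP => x; rewrite mem_finsupp finsym_mulE => kx.
case: (boolP (x \in finsupp (perm_shift h p.1))) => [xp|].
  apply/bigfcupP; exists p; rewrite ?pS //; apply/bigfcupP; exists h => //.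
  by rewrite hF.
rewrite memNfinsupp => /eqP px; move: kx; rewrite px => kx.
by apply: (fsubsetP kV); rewrite mem_finsupp.
Qed.

(** * Wreath products with Z/2 *)

Lemma Zmod2_cases (x : Zmod2) : x = 1 \/ x = (1%R : 'Z_2).
Proof.
by case: x => -[|[|//]] i; [left|right]; apply: val_inj.
Qed.

Lemma ex_lamps_supp (T : choiceType) (V : {fset T}) :
  exists2 K : {fset dirsum T Zmod2}, (#|` K| <= 2 ^ #|` V|)%N &
    forall f, (f \in K) = (finsupp f `<=` V).
Proof.
pose e (W : {fset T}) : dirsum T Zmod2 := [fsfun x in W => (1%R : 'Z_2)].
exists (e @` fpowerset V).
  by rewrite -card_fpowerset leq_imfset_card.
move=> f; apply/imfsetP/idP => [[W /=]|fV].
  rewrite fpowersetE => WV ->; apply: fsubset_trans WV.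
  by apply/fsubsetP => x; rewrite mem_finsupp fsfunE; case: ifP; rewrite ?eqxx.
exists (finsupp f); first by rewrite fpowersetE.
apply/fsfunP => x; rewrite fsfunE; case: finsuppP => // xf.
have [fx|//] := Zmod2_cases (f x); by rewrite mem_finsupp fx eqxx in xf.
Qed.

Lemma folner_wreath (H : groupType) (T : {fset wreath Zmod2 H}) :
  exists U : nat, forall (F : {fset H}) r, F != fset0 ->
    {in [fset p.2 | p in T], forall h, (r * leak F h <= #|` F|)%N} ->
  exists B : {fset wreath Zmod2 H}, [/\ B != fset0,
    {in T, forall t, (r * leak B t <= #|` B|)%N} & (#|` B| <= 2 ^ (U * #|` F|))%N].
Proof.
pose D := \bigcup_(p <- T) finsupp p.1.
(* The lamps live on at most [#|D| * #|F|] points; the additional 1 absorbs the factor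
   [#|F| <= 2 ^ #|F|]. Thus [U] depends on [T] only. *)
exists #|` D|.+1 => F r F0 FS.
pose V := [fset h * x | h in F, x in D].
have [K Kcard KE] := ex_lamps_supp V.
have cV : (#|` V| <= #|` D| * #|` F|)%N.
  rewrite mulnC -(size_allpairs (fun h x => h * x)).
  apply: uniq_leq_size => // x /imfset2P[h hF [y yD ->]].
  by apply/allpairsP; exists (h, y).
exists (sdprod_fset (lamp_shift_action Zmod2 H) K F); split.
- apply: sdprod_fset_neq0 => //; apply/fset0Pn; exists 1; rewrite KE.
  by apply/fsubsetP => x; rewrite mem_finsupp dirsum_oneE eqxx.
- apply: folner_sdprod => // k h p; rewrite !KE => kV hF pT.
  apply/fsubsetP => x; rewrite mem_finsupp dirsum_mulE => kx.
  case: (boolP (x \in finsupp k)) => [/(fsubsetP kV) //|].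
  rewrite memNfinsupp => /eqP kx1; move: kx; rewrite kx1 mul1g lamp_shiftE => hx.
  apply/imfset2P; exists h => //; exists (h^-1 * x); rewrite ?mulVKg //.
  by apply/bigfcupP; exists p; rewrite ?pT // mem_finsupp.
rewrite card_sdprod_fset mulSn addnC expnD; apply: leq_mul.
  by apply: (leq_trans Kcard); rewrite leq_pexp2l.
exact/ltnW/ltn_expl.
Qed.

(** * Lower bound for lampshufflers *)

Section Transpositions.
Context (T : choiceType).
Implicit Types a b x : T.

Definition swap a b x := if x == a then b else if x == b then a else x.

Lemma swapK a b : involutive (swap a b).
Proof.
move=> x; rewrite /swap; have [->|xa] := eqVneq x a.
  by rewrite eqxx; case: eqVneq => // ->.
by have [->|xb] := eqVneq x b; rewrite ?eqxx // (negPf xa) (negPf xb).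
Qed.

Lemma swapL a b : swap a b a = b. Proof. by rewrite /swap eqxx. Qed.

Lemma swapR a b : swap a b b = a.
Proof. by rewrite /swap eqxx; case: eqVneq. Qed.

Lemma swap_id a b x : x != a -> x != b -> swap a b x = x.
Proof. by rewrite /swap => /negPf-> /negPf->. Qed.

Lemma swap_inj_comm (f : T -> T) a b x :
  injective f -> swap (f a) (f b) (f x) = f (swap a b x).
Proof. by move=> f_inj; rewrite /swap !(inj_eq f_inj); case: (x == a); case: (x == b). Qed.

Definition fswap a b : {fsfun T -> T} := [fsfun x in [fset a; b] => swap a b x].

Lemma fswapE a b x : fswap a b x = swap a b x.
Proof.
rewrite fsfunE !inE; case: ifPn => //; rewrite negb_or => /andP[xa xb].
by rewrite swap_id.
Qed.

Lemma fswap_bij a b : `[< bijective (fswap a b) >].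
Proof. by apply/asboolP; exists (swap a b) => x; rewrite fswapE swapK. Qed.

Definition transp a b : finsym T := FinSym (fswap_bij a b).

Lemma transpE a b x : transp a b x = swap a b x.
Proof. exact: fswapE. Qed.

Lemma transpK a b : transp a b * transp a b = 1.
Proof. by apply/finsymP => x; rewrite finsym_mulE finsym_oneE !transpE swapK. Qed.

Lemma transp_conj (s : finsym T) a b : s * transp a b = transp (s a) (s b) * s.
Proof.
apply/finsymP => x; rewrite !finsym_mulE !transpE swap_inj_comm //.
exact: bij_inj (finsym_bij s).
Qed.
End Transpositions.

(** * The action of the lampshuffler and the fibers over permutations *)

Section ShufflerMoves.
Context (H : groupType).
Implicit Types (g : Shuffler H) (s : finsym H) (h a b x : H).

Definition shift_of h : Shuffler H := (1, h).
Definition transp_of a b : Shuffler H := (transp a b, 1).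
Definition move_point g x : H := g.1 (g.2 * x).

Lemma Shuffler_mulE s t h k :
  ((s, h) : Shuffler H) * (t, k) = (s * perm_shift h t, h * k).
Proof. by []. Qed.

Lemma perm_shift_transp h a b : perm_shift h (transp a b) = transp (h * a) (h * b).
Proof.
apply/finsymP => x; rewrite perm_shiftE !transpE -{2}[x](mulVKg h).
by rewrite swap_inj_comm //; apply: mulgI.
Qed.

Lemma mul_transp_of g a b :
  g * transp_of a b = (g.1 * transp (g.2 * a) (g.2 * b), g.2).
Proof. by case: g => s h; rewrite Shuffler_mulE mulg1 perm_shift_transp. Qed.

Lemma mul_shift_of g h : g * shift_of h = (g.1, g.2 * h).
Proof.
case: g => s k; have k1 : perm_shift k 1 = 1 := aact_g1 (perm_shift_action H) k.
by rewrite Shuffler_mulE k1 mulg1.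
Qed.

Lemma transp_ofK a b g : g * transp_of a b * transp_of a b = g.
Proof. by rewrite !mul_transp_of /= -mulgA transpK mulg1; case: g. Qed.

Lemma transp_of_conj g a b :
  g * transp_of a b = transp_of (move_point g a) (move_point g b) * g.
Proof.
rewrite mul_transp_of transp_conj; case: g => s h.
by rewrite /transp_of Shuffler_mulE mul1g perm_shift1.
Qed.

Lemma move_point_transp g a b x :
  move_point (g * transp_of a b) x = move_point g (swap a b x).
Proof.
rewrite mul_transp_of /move_point [LHS]finsym_mulE transpE swap_inj_comm //.
exact: mulgI.
Qed.

Lemma leak_transp_move (A : {fset Shuffler H}) g a b :
  (leak A (transp_of (move_point g a) (move_point g b)) <=
   leak A (transp_of a b) + 2 * leak A g)%N.
Proof. by have := leakJ A (transp_of a b) g; rewrite transp_of_conj mulgK. Qed.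

Definition perm_fiber (A : {fset Shuffler H}) s : {fset H} := [fset p.2 | p in A & p.1 == s].

Lemma in_perm_fiber A s h : (h \in perm_fiber A s) = ((s, h) \in A).
Proof.
apply/imfsetP/idP => [[[t k]] /=|sA]; last by exists (s, h); rewrite ?inE ?sA /=.
by rewrite !inE /= => /andP[tA /eqP <-] ->.
Qed.

Lemma count_perm_fiber (A : {fset Shuffler H}) s (P : pred (Shuffler H)) :
  count (fun p => P p && (p.1 == s)) A = count (fun h => P (s, h)) (perm_fiber A s).
Proof.
apply/eqP; rewrite eqn_leq; apply/andP; split.
  apply: (@count_inj_leq _ _ _ _ _ _ (fun p : Shuffler H => p.2)).
    by move=> [t h] [u k] /andP[_ /andP[_ /eqP /= ->]] /andP[_ /andP[_ /eqP /= ->]] ->.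
  by move=> [t h] tA /= /andP[Pt /eqP <-]; rewrite in_perm_fiber tA.
apply: (@count_inj_leq _ _ _ _ _ _ (fun h => (s, h) : Shuffler H)).
  by move=> h k _ _ [].
by move=> h; rewrite in_perm_fiber => -> ->; rewrite eqxx.
Qed.

Lemma leak_perm_fiber (A : {fset Shuffler H}) h :
  leak A (shift_of h) =
  \sum_(s <- [fset p.1 | p in A]) leak (perm_fiber A s) h.
Proof.
rewrite /leak (count_fibers A (fun p : Shuffler H => p.1)); apply: eq_bigr => s _.
rewrite count_perm_fiber; apply: eq_count => k /=.
by rewrite mul_shift_of in_perm_fiber.
Qed.

Lemma card_perm_fiber (A : {fset Shuffler H}) (Q : pred (finsym H)) :
  count (fun p => Q p.1) A =
  \sum_(s <- [fset p.1 | p in A]) (Q s * #|` perm_fiber A s|)%N.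
Proof.
rewrite (count_fibers A (fun p : Shuffler H => p.1)); apply: eq_bigr => s _.
rewrite count_perm_fiber /= -[#|` _|]count_predT.
by case: (Q s); rewrite ?mul1n ?mul0n // count_pred0.
Qed.
End ShufflerMoves.

(* Discard the permutations whose fiber in [A] is not a Følner set, then prune:
   each remaining permutation [s] keeps [2 N] points [h] such that
   [s * transp h (h * x)] remains. *)
Lemma Shuffler_folner_card (H : groupType) (S : {fset H}) (x : H) (r C N : nat)
    (A : {fset Shuffler H}) :
    x != 1 -> A != fset0 -> (4 * C <= r)%N -> (0 < r)%N ->
    {in S, forall h, (r * leak A (shift_of h) <= C * #|` A|)%N} ->
    (r * leak A (transp_of 1 x) <= C * #|` A|)%N ->
    (forall F : {fset H}, F != fset0 ->
       {in S, forall h, (r * leak F h <= 4 * (C * #|` S|).+1 * #|` F|)%N} ->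
     (16 * N <= #|` F|)%N) ->
  (2 ^ N <= #|` A|)%N.
Proof.
move=> x1 A0 rC r0 AS Ax HN; set C1 := (4 * _)%N in HN.
pose good s := all (fun h => r * leak (perm_fiber A s) h <= C1 * #|` perm_fiber A s|)%N S.
pose A1 := [fset p in A | good p.1].
have cA1 P : count P A1 = count (fun p => good p.1 && P p) A.
  exact: count_fset_filter.
(* Markov's inequality: each bad fiber leaks beyond the threshold [C1] for some [h] in [S], and the
   leaks over [S] total at most [C * #|S| * #|A| / r]. *)
have bad : (4 * count (fun p => ~~ good p.1) A <= #|` A|)%N.
  suff : (C1 * count (fun p => ~~ good p.1) A <= C * #|` S| * #|` A|)%N.
    by rewrite /C1; move: (C * _)%N (count _ _) (#|` A|) => c b n; clear; nia.
  apply: (@leq_trans (\sum_(h <- S) r * leak A (shift_of h))%N); last first.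
    rewrite mulnAC mulnC -sum_nat_fset_const.
    by rewrite big_seq [leqRHS]big_seq; apply: leq_sum => h /AS.
  rewrite (card_perm_fiber A (fun s => ~~ good s)) big_distrr /=.
  under [leqRHS]eq_bigr do rewrite leak_perm_fiber big_distrr /=.
  rewrite exchange_big /=; apply: leq_sum => s _.
  case: (boolP (good s)) => [_|/allPn[h hS]] /=; first by rewrite mul0n muln0.
  rewrite -ltnNge mul1n => /ltnW /leq_trans; apply.
  by rewrite (big_fsetD1 h) //= leq_addr.
have A1card : (3 * #|` A| <= 4 * #|` A1|)%N.
  have E : (count (fun p => good p.1) A + count (fun p => ~~ good p.1) A)%N = #|` A|.
    exact: count_predC.
  have -> : #|` A1| = count (fun p => good p.1) A.
    by rewrite -[LHS]count_predT cA1; apply: eq_count => p; rewrite andbT.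
  by lia.
have A10 : A1 != fset0.
  by move: A0; rewrite -!cardfs_gt0; lia.
pose i (p : Shuffler H) := p * transp_of 1 x.
(* Leaks and bad fibers cost a quarter of [A] each, that is, at most two thirds of [A1]. *)
have stay : (#|` A1| <= 4 * count (fun p => i p \in A1) A1)%N.
  have : (#|` A1| <= count (fun p => i p \in A1) A1 +
     (leak A (transp_of 1 x) + count (fun p => ~~ good p.1) A))%N.
    rewrite -{1}(count_predC (fun p => i p \in A1) A1) leq_add2l.
    rewrite cA1 /leak; apply: (@leq_trans (leak A (transp_of 1 x) +
        count (fun p => ~~ good (i p).1 && (i p \in A)) A)%N).
      apply: count_leqD => p pA /andP[_]; rewrite !inE /=.
      by case: (_ \in A); rewrite //= andbT.
    rewrite leq_add2l; apply: (@count_inj_leq _ _ _ _ _ _ i).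
      by move=> p q _ _ /mulIg.
    by move=> p _ /andP[-> ->].
  have : (4 * leak A (transp_of 1 x) <= #|` A|)%N.
    rewrite -(leq_pmul2l r0) mulnCA; apply: (@leq_trans (4 * (C * #|` A|))%N).
      by rewrite leq_mul2l Ax.
    by rewrite mulnA leq_mul2r rC orbT.
  by lia.
have [P [P0 PA1 PP]] := @prune_fibers _ _ i (fun p => p.1) A1 4
  (transp_ofK 1 x) A10 stay.
have [s0 s0P] := fset0Pn _ P0.
have PA : (#|` P| <= #|` A|)%N.
  apply: (@leq_trans #|` [fset p.1 | p in A]|); last exact: leq_imfset_card.
  apply/fsubset_leq_card; apply: fsubset_trans PA1 _.
  by apply: subset_imfset => p; rewrite !inE => /andP[].
apply: leq_trans PA; apply: (branching_card (f := fun s : finsym H => s)) s0P => Z s ZN sP.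
pose F := perm_fiber A s.
pose step h : finsym H := s * transp h (h * x).
have /imfsetP[[s' h0] /=] := fsubsetP PA1 s sP.
rewrite !inE /= => /andP[sA sgood] Es; rewrite -{s'}Es in sA sgood.
have F16 : (16 * N <= #|` F|)%N.
  apply: HN => [|h hS]; last exact: (allP sgood).
  by apply/fset0Pn; exists h0; rewrite in_perm_fiber.
(* Pruning with [c = 4] gives the factor 8, so at least [2 * N] points [h] of [F] are usable. Fewer
   than [2 * N] of them have [h] or [h * x] in [Z]. *)
have FP : (#|` F| <= 8 * count (fun h => step h \in P) F)%N.
  move: (PP s sP); rewrite cA1.
  rewrite (count_perm_fiber A s (fun p => good p.1)) /= (eq_count (a2 := predT)) => [|h].
    rewrite count_predT => /leq_trans; apply; rewrite leq_mul2l; apply/orP; right.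
    rewrite cA1; apply: (@leq_trans (count (fun p : Shuffler H =>
      ((i p).1 \in P) && (p.1 == s)) A)).
      by apply: sub_count => p /and4P[_ -> _ ->].
    rewrite (count_perm_fiber A s (fun p => (i p).1 \in P)).
    by apply: sub_count => h; rewrite /i mul_transp_of /= mulg1.
  by rewrite sgood.
have cZ (f : H -> H) : injective f -> (count (fun h => f h \in Z) F <= #|` Z|)%N.
  move=> f_inj; rewrite -[#|` Z|]count_predT.
  by apply: (@count_inj_leq _ _ _ _ _ _ f) => [? ? _ _ /f_inj|? _ ->].
have /hasP[h hF /and3P[hP hZ hxZ]] : has (fun h =>
    [&& step h \in P, h \notin Z & h * x \notin Z]) F.
  apply/negPn/negP => /hasPn none.
  have : (count (fun h => step h \in P) F <=
      count (fun h => h \in Z) F + count (fun h => (h * x)%g \in Z) F)%N.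
    apply: count_leqD => h /none; rewrite !negb_and !negbK => /orP[/negPf->//|//].
  have Z1 : (count (fun h => h \in Z) F <= #|` Z|)%N := cZ id (fun _ _ => id).
  have Z2 : (count (fun h => (h * x)%g \in Z) F <= #|` Z|)%N := cZ _ (@mulIg _ x).
  by lia.
exists h, [fset s h; s (h * x)].
  rewrite cardfs2 (inj_eq (bij_inj (finsym_bij s))) -{1}[h]mulg1.
  by rewrite (inj_eq (@mulgI _ h)) eq_sym x1.
move=> v; rewrite !inE => /orP[/eqP->|/eqP->]; first by exists s.
exists (step h) => //; split=> [|z zZ].
  by rewrite [LHS]finsym_mulE transpE swapL.
rewrite [LHS]finsym_mulE transpE swap_id //.
  by apply: contraNneq hZ => <-.
by apply: contraNneq hxZ => <-.
Qed.

Lemma folner_dominates_step (X Y : groupType) (x : X) :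
  x != 1 -> folner_dominates X Y -> folner_dominates (Shuffler X) (wreath Zmod2 Y).
Proof.
move=> x1 [S dom].
exists (transp_of 1 x |` [fset shift_of h | h in S]) => T K C.
have [U TU] := folner_wreath T.
(* The term [16 * (U + K)] yields [N = (U + K) * #|B|], where [2 ^ (U * #|B|)] bounds [#|B'|] and
   the rest absorbs [K]; the other terms force [4 * C <= r], [K <= r] and [0 < r]. *)
have [r [B [Kr B0 BT BA]]] := dom [fset p.2 | p in T] (16 * (U + K) + 4 * C + K).+1
  (4 * (C * #|` S|).+1)%N.
have [B' [B'0 B'T B'card]] := TU B r B0 BT.
exists r, B'; split=> //; first by lia.
move=> A A0 AS; apply: (@leq_trans (2 ^ ((U + K) * #|` B|))%N).
  rewrite mulnDl expnD mulnC; apply: leq_mul => //.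
  apply/ltnW/(leq_trans (ltn_expl K (isT : 1 < 2))).
  by rewrite leq_pexp2l // leq_pmulr // cardfs_gt0.
apply: (@Shuffler_folner_card _ S x r C) => //; try lia.
- by move=> h hS; apply: AS; rewrite !inE; apply/orP; right; apply/imfsetP; exists h.
- by apply: AS; rewrite !inE eqxx.
move=> F F0 FS; apply: leq_trans (BA F F0 FS); rewrite mulnA leq_mul2r; lia.
Qed.

Lemma Shuffler_nontrivial (X : groupType) (x : X) : x != 1 -> exists y : Shuffler X, y != 1.
Proof. by move=> x1; exists (1, x); apply: contraNneq x1 => -[->]. Qed.

(** * Free abelian groups *)

Definition l1norm d (v : 'rV[int]_d) : nat := \sum_i absz (v ord0 i).
Definition unitvec d (i : 'I_d) : Zpow d := (delta_mx ord0 i : 'rV[int]_d).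

Lemma subadditive_l1norm d (f : Zpow d -> nat) M :
    f 1 = 0%N -> (forall x y, f (x * y)%g <= f x + f y)%N ->
    (forall x, f x^-1%g <= f x)%N -> (forall i, f (unitvec i) <= M)%N ->
  forall v, (f v <= l1norm v * M)%N.
Proof.
move=> f1 fM fV fe v.
rewrite [v in f v]row_sum_delta.
rewrite /l1norm big_distrl /=; elim/big_rec2: _ => [|i m w _ fw].
  by rewrite -[X in (_ <= X)%N]f1.
apply: leq_trans (fM _ _) (leq_add _ fw).
have fn n : (f ((delta_mx ord0 i : 'rV[int]_d) *+ n)%R <= n * M)%N.
  elim: n => [|n IH]; first by rewrite mulr0n -[X in (_ <= X)%N]f1.
  by rewrite mulrS mulSn; apply: leq_trans (fM _ _) (leq_add (fe i) IH).
have nE (n : nat) : (n%:Z *: (delta_mx ord0 i : 'rV[int]_d) = delta_mx ord0 i *+ n)%R.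
  by rewrite -natz scaler_nat.
case: (v ord0 i) => n; first by rewrite nE.
rewrite NegzE scaleNr nE abszN.
exact: leq_trans (fV _) (fn _).
Qed.

Section Box.
Context (d R : nat).

Definition box_point (g : {ffun 'I_d -> 'I_R}) : Zpow d :=
  (\row_i (g i : nat)%:Z)%R : 'rV[int]_d.

Definition box : {fset Zpow d} := [fset box_point g | g : {ffun 'I_d -> 'I_R}].

Lemma box_point_inj : injective box_point.
Proof.
move=> g h /rowP gh; apply/ffunP => i; apply/val_inj.
by have := gh i; rewrite !mxE => -[].
Qed.

Lemma card_box : #|` box| = (R ^ d)%N.
Proof.
rewrite card_imfset; last exact: box_point_inj.
by rewrite /= -cardE card_ffun !card_ord.
Qed.

Lemma in_box (v : 'rV[int]_d) :
  reflect (forall i, (0 <= v ord0 i < R%:Z)%R) ((v : Zpow d) \in box).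
Proof.
apply: (iffP (imfsetP _ _ _ _)) => [[g _ ->] i|vR]; first by rewrite mxE lez_nat ltz_nat ltn_ord.
have vR' i : (`|v ord0 i| < R)%N by have := vR i; lia.
exists [ffun i => Ordinal (vR' i)] => //; apply/rowP => i.
by rewrite mxE ffunE /= gez0_abs //; case/andP: (vR i).
Qed.

(** Only the face with [i]-th coordinate [R - 1] leaks, and it translates into each of the [R]
    disjoint slices of the box. *)
Lemma leak_box_unitvec i : (R * leak box (unitvec i) <= #|` box|)%N.
Proof.
rewrite -[#|` box|]count_predT.
have slice (c : 'I_R) : (leak box (unitvec i) <=
    count (fun v : Zpow d => (v : 'rV[int]_d) ord0 i == Posz c) box)%N.
  pose e : 'rV[int]_d := delta_mx ord0 i.
  apply: (@count_inj_leq _ _ _ _ _ _ (fun v : Zpow d =>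
    (v : 'rV[int]_d) - e *+ (R - c.+1) : Zpow d)%R).
    by move=> v w _ _ /addIr.
  move=> v /in_box vR vi.
  have vie : (v : 'rV[int]_d) ord0 i = (R%:Z - 1)%R.
    apply/eqP; apply: contraNT vi => vi; apply/in_box => j.
    rewrite mxE [X in (_ + X)%R]mxE eqxx /=; have := vR j.
    by case: eqVneq => [->|_]; move: vi => /eqP; lia.
  apply/andP; split.
    apply/in_box => j; rewrite mxE [X in (_ + X)%R]mxE mulmxnE mxE eqxx /=.
    have := vR j; have := ltn_ord c.
    by case: eqVneq => [->|_] /=; rewrite ?vie; lia.
  rewrite mxE [X in (_ + X)%R]mxE mulmxnE mxE !eqxx vie; have := ltn_ord c; lia.
apply: (@leq_trans (\sum_(c <- enum 'I_R) 
    count (fun v : Zpow d => (v : 'rV[int]_d) ord0 i == Posz c) box)%N).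
  rewrite -{1}(size_enum_ord R) mulnC -[size _]count_predT -iter_addn_0 -big_const_seq.
  exact: leq_sum.
rewrite count_pair_swap -sum1_count; apply: leq_sum => v _.
have /count_uniq_mem c1 := enum_uniq 'I_R.
have [/existsP[c vc]|/existsPn none] := boolP
    [exists c : 'I_R, (v : 'rV[int]_d) ord0 i == Posz c].
  rewrite (eq_count (a2 := pred1 c)) ?c1 ?leq_b1 // => c' /=.
  by rewrite (eqP vc) eqz_nat eq_sym.
rewrite (eq_count (a2 := pred0)) => [|c /=]; first by rewrite count_pred0.
by move: (none c) => /negPf.
Qed.
End Box.

Lemma leak_box d R (v : Zpow d) : (R * leak (box d R) v <= l1norm v * #|` box d R|)%N.
Proof.
apply: (@subadditive_l1norm _ (fun v => R * leak (box d R) v)%N) => [|x y|x|i].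
- by rewrite leak1 muln0.
- by rewrite -mulnDr leq_mul2l leakM orbT.
- by rewrite leq_mul2l leakV orbT.
- exact: leak_box_unitvec.
Qed.

(** The factor [c] is fixed before [r], so the cardinality is polynomial in [r], of degree [d]. *)
Lemma Zpow_folner d (T : {fset Zpow d}) : exists2 c, (0 < c)%N &
  forall r, (0 < r)%N -> exists F : {fset Zpow d}, [/\ F != fset0,
    {in T, forall t, (r * leak F t <= #|` F|)%N} & #|` F| = ((c * r) ^ d)%N].
Proof.
exists (\sum_(t <- T) l1norm t).+1 => // r r0.
set c := _.+1; exists (box d (c * r)); split; last exact: card_box.
  by rewrite -cardfs_gt0 card_box expn_gt0 muln_gt0 r0.
move=> t tT; rewrite -(leq_pmul2l (ltn0Sn _ : 0 < c)%N) mulnA.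
apply: leq_trans (leak_box _ _) _; rewrite leq_mul2r; apply/orP; right.
by rewrite /c (big_fsetD1 t) //= ltnW // ltnS leq_addr.
Qed.

Lemma amenable_Zpow d : amenable (Zpow d).
Proof.
move=> S r; have [c c0 /(_ r.+1 isT)[F [F0 FS _]]] := Zpow_folner S.
exists F => // s /FS; apply: leq_trans; by rewrite leq_mul2r leqnSn orbT.
Qed.

(** * The base case: lampshufflers over free abelian groups *)

Lemma count_fsetM (T U : choiceType) (A : {fset T}) (B : {fset U}) (P : pred (T * U)) :
  count P (A `*` B) = \sum_(x <- A) count (fun y => P (x, y)) B :> nat.
Proof.
have -> : count P (A `*` B) = count P [seq (x, y) | x <- A, y <- B].
  apply/permP/uniq_perm; rewrite ?fset_uniq //.
    by apply: allpairs_uniq => // -[x y] [x' y'] _ _ [-> ->].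
  move=> [x y]; rewrite in_fsetM /=; apply/andP/allpairsP => [[xA yB]|].
    by exists (x, y).
  by case=> -[x' y'] [/= xA yB [-> ->]].
elim: (enum_fset A) => [|x s IH]; first by rewrite big_nil.
by rewrite big_cons /= count_cat count_map IH.
Qed.

Lemma cardfsM (T U : choiceType) (A : {fset T}) (B : {fset U}) :
  #|` A `*` B| = (#|` A| * #|` B|)%N.
Proof.
rewrite -count_predT count_fsetM -sum_nat_fset_const.
by under eq_bigr do rewrite count_predT.
Qed.

Lemma unitvec_expg d (i : 'I_d) n : ((unitvec i ^+ n : Zpow d) : 'rV[int]_d) ord0 i = n%:Z%R.
Proof.
have -> : (unitvec i ^+ n : Zpow d) = ((delta_mx ord0 i : 'rV[int]_d) *+ n)%R by [].
by rewrite mulmxnE mxE !eqxx -[RHS]natz.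
Qed.

(* Here each remaining [g] keeps [q] transpositions moving a same point of the
   box; using [q] of them, and not only one, is what gives the factor [log]. *)
Lemma Shuffler_Zpow_card d (i : 'I_d) (A : {fset Shuffler (Zpow d)}) (q n : nat) :
    (0 < q)%N -> A != fset0 -> (16 * n = (8 * q) ^ d)%N ->
    (forall x j, x \in box d (8 * q) -> (0 < j <= 8 * q)%N ->
      (2 * leak A (transp_of x (x * unitvec i ^+ j)%g) <= #|` A|)%N) ->
  (q ^ n <= #|` A|)%N.
Proof.
move=> q0 A0 nE Aleak; set R := (8 * q)%N in nE Aleak.
have R0 : (0 < R)%N by rewrite muln_gt0.
pose r : {fset nat} := [fset j in iota 1 R].
have cr : #|` r| = R by rewrite card_fseq undup_id ?iota_uniq // size_iota.
have inr j : (j \in r) = (0 < j <= R)%N by rewrite inE mem_iota add1n ltnS.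
pose J : {fset (Zpow d * nat)%type} := box d R `*` r.
have cJ : #|` J| = (16 * n * R)%N by rewrite cardfsM card_box cr nE.
pose e j : Zpow d := unitvec i ^+ j.
have e_inj : injective e.
  move=> j k jk; have := unitvec_expg i j; rewrite -/(e j) jk unitvec_expg.
  by case.
have e1 j : (0 < j)%N -> e j != 1.
  by move=> j0; apply: contraTneq j0 => /(e_inj j 0) ->.
pose t (y : Zpow d * nat) : Shuffler (Zpow d) := transp_of y.1 (y.1 * e y.2).
(* Keeping the pair [(x, j)] as a label lets a single pruning treat all the transpositions at once,
   with a common set [P]. *)
pose I (p : Shuffler (Zpow d) * (Zpow d * nat)) := (p.1 * t p.2, p.2).
have IK : involutive I by move=> [g y]; rewrite /I /= transp_ofK.
have AJ0 : A `*` J != fset0.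
  by rewrite -cardfs_gt0 cardfsM muln_gt0 cardfs_gt0 A0 cJ nE muln_gt0 expn_gt0 R0.
have stay : (#|` A `*` J| <= 2 * count (fun p => I p \in A `*` J) (A `*` J))%N.
  rewrite cardfsM count_fsetM count_pair_swap mulnC -sum_nat_fset_const big_distrr /=.
  rewrite big_seq [leqRHS]big_seq; apply: leq_sum => y yJ.
  rewrite (eq_count (a2 := fun g => g * t y \in A)) => [|g]; last first.
    by rewrite in_fsetM /= yJ andbT.
  rewrite count_stay; move: yJ; rewrite in_fsetM => /andP[y1 y2].
  rewrite inr in y2; have : (2 * leak A (t y) <= #|` A|)%N := Aleak y.1 y.2 y1 y2.
  have aux m l : (2 * l <= m -> m <= 2 * (m - l))%N by lia.
  exact: aux.
have [P [P0 PA PP]] := @prune_fibers _ _ I fst (A `*` J) 2 IK AJ0 stay.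
have [g0 g0P] := fset0Pn _ P0.
have PA' : P `<=` A.
  apply: fsubset_trans PA _; apply/fsubsetP => g /imfsetP[[g' y] /=].
  by rewrite in_fsetM => /andP[g'A _] ->.
apply: leq_trans (fsubset_leq_card PA').
apply: (branching_card (f := @move_point (Zpow d))) g0P => Z g Zn gP.
pose ok y := g * t y \in P.
have Jok : (16 * n * R <= 4 * count ok J)%N.
  have gA := fsubsetP PA' g gP.
  rewrite -cJ -[#|` J|]count_predT; apply: (@leq_trans (count (fun p => p.1 == g) (A `*` J))).
    apply: (@count_inj_leq _ _ _ _ _ _ (fun y => (g, y))); first by move=> ? ? _ _ [].
    by move=> y yJ _; rewrite in_fsetM gA yJ eqxx.
  apply: leq_trans (PP g gP) _; rewrite leq_mul2l; apply/orP; right.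
  apply: (@count_inj_leq _ _ _ _ _ _ snd).
    move=> [h y] [k z] /andP[_ /and3P[/eqP/= -> _ _]] /andP[_ /and3P[/eqP/= -> _ _]] /=.
    by move=> ->.
  move=> [h y]; rewrite in_fsetM => /andP[/= _ yJ] /and3P[/eqP/= -> _ hP].
  by rewrite yJ.
have cZ (f : Zpow d * nat -> Zpow d) : injective (fun y => (f y, y.2)) ->
    (count (fun y => f y \in Z) J <= #|` Z| * R)%N.
  move=> f_inj; rewrite -cr -cardfsM -[X in (_ <= X)%N]count_predT.
  apply: (@count_inj_leq _ _ _ _ _ _ (fun y => (f y, y.2))); first by move=> ? ? _ _ /f_inj.
  by move=> y; rewrite in_fsetM => /andP[_ y2] yZ; rewrite in_fsetM /= yZ y2.
pose good y := [&& ok y, y.1 \notin Z & y.1 * e y.2 \notin Z].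
(* At least [4 * n * R = 32 * n * q] pairs stay in [P], and [Z] excludes fewer than
   [2 * n * R = 16 * n * q]. So one of the [16 * n] points of the box has [q] good values of [j]. *)
have /hasP[x xB xq] : has (fun x => q <= count (fun j => good (x, j)) r)%N (box d R).
  apply/negPn/negP => /hasPn none.
  have cgood : (count good J <= 16 * n * q.-1)%N.
    rewrite count_fsetM nE -card_box -sum_nat_fset_const.
    rewrite big_seq [leqRHS]big_seq; apply: leq_sum => x /none.
    by rewrite -ltnNge => xq; rewrite -ltnS prednK.
  have : (count ok J <= count good J + (count (fun y => y.1 \in Z) J +
      count (fun y => (y.1 * e y.2)%g \in Z) J))%N.
    apply: (@leq_trans (count good J +
      count (predU (fun y => y.1 \in Z) (fun y => (y.1 * e y.2)%g \in Z)) J)%N).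
      apply: count_leqD => y _ oky; rewrite /good oky /=.
      by case: (y.1 \in Z) => //=; case: (_ \in Z).
    by rewrite leq_add2l; apply: count_leqD.
  have Z1 : (count (fun y => y.1 \in Z) J <= #|` Z| * R)%N.
    by apply: (cZ fst) => -[? ?] [? ?].
  have Z2 : (count (fun y => (y.1 * e y.2)%g \in Z) J <= #|` Z| * R)%N.
    apply: (cZ (fun y => y.1 * e y.2)) => -[x j] [y k] /= [xy jk].
    by move: xy; rewrite jk => /mulIg ->.
  move: Jok cgood Zn Z1 Z2; rewrite /R; case: (q) q0 => // q' _ /=.
  move: (count ok J) (count good J) (count _ J) (count _ J) (#|` Z|) => a b c1 c2 z.
  by nia.
exists x, [fset move_point g (x * e j) | j in r & good (x, j)].
  rewrite card_in_imfset /=; last first.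
    move=> j k _ _ /(bij_inj (finsym_bij g.1))/mulgI/mulgI; exact: e_inj.
  apply: (leq_trans xq); rewrite -size_filter leq_eqVlt; apply/orP; left.
  by apply/eqP/perm_size/uniq_perm; rewrite ?filter_uniq ?fset_uniq //.
move=> v /imfsetP[j /=]; rewrite !inE => /andP[jr /and3P[okj xZ xjZ]] ->.
exists (g * t (x, j)) => //; split=> [|z zZ].
  by rewrite move_point_transp swapL.
rewrite move_point_transp swap_id //; first by apply: contraNneq xZ => <-.
by apply: contraNneq xjZ => <-.
Qed.

(* With [u := transp_of 1 h * shift_of h], the permutation [move_point u] fixes
   [1] and sends [h ^+ j] to [h ^+ j.+1] for [j > 0], so conjugating by [u] lengthens
   [transp_of 1 (h ^+ j)] by one step. *)
Lemma leak_transp_expg (H : groupType) (A : {fset Shuffler H}) (h : H) j :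
    (forall k, (0 < k)%N -> h ^+ k != 1) ->
  (leak A (transp_of 1 (h ^+ j.+1)) <=
   leak A (transp_of 1 h) + 2 * j * (leak A (transp_of 1 h) + leak A (shift_of h)))%N.
Proof.
move=> hk; pose u : Shuffler H := transp_of 1 h * shift_of h.
have uE x : move_point u x = swap 1 h (h * x).
  by rewrite /u mul_shift_of /move_point /= mul1g; apply: transpE.
have lu : (leak A u <= leak A (transp_of 1 h) + leak A (shift_of h))%N := leakM A _ _.
elim: j => [|j IH]; first by rewrite muln0 mul0n addn0 expg1.
have <- : move_point u 1 = 1 by rewrite uE mulg1 swapR.
have uh : move_point u (h ^+ j.+1) = h ^+ j.+2.
  rewrite uE -expgS swap_id //; first exact: hk.
  apply: contraNneq (hk j.+1 isT) => hh; apply/eqP/(mulgI h).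
  by rewrite mulg1 -expgS.
rewrite -{1}uh; apply: leq_trans (leak_transp_move _ _ _ _) _.
have -> : move_point u 1 = 1 by rewrite uE mulg1 swapR.
by move: IH lu; move: (leak A _) (leak A _) (leak A _) (leak A _) => a b c e; nia.
Qed.

(** After multiplication by [m * rho], the three terms cost 2, 8 and 4 times [d.+1 * rho * C * n],
    whence 14. *)
Lemma leak_arith (d rho j n C K a b y : nat) :
    let m := (14 * d.+1 * C + K).+1 in
    (0 < rho)%N -> (j <= rho)%N ->
    (m * rho * a <= C * n)%N -> (m * rho * b <= C * n)%N ->
    (m * rho * y <= d.+1 * rho * (C * n))%N ->
  (2 * (a + 2 * j * (a + b) + 2 * y) <= n)%N.
Proof.
move=> m rho0 jr ha hb hy.
have mr0 : (0 < m * rho)%N by rewrite muln_gt0 rho0.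
rewrite -(leq_pmul2l mr0).
have jab : (m * rho * (j * (a + b)) <= rho * (2 * (C * n)))%N.
  rewrite mulnCA; apply: leq_mul => //; lia.
have one : (C * n <= d.+1 * rho * (C * n))%N by rewrite leq_pmull // muln_gt0 rho0.
have two : (rho * (C * n) <= d.+1 * rho * (C * n))%N.
  by rewrite -mulnA leq_pmull.
have three : (14 * (d.+1 * rho * (C * n)) <= m * rho * n)%N.
  have -> : (14 * (d.+1 * rho * (C * n)) = 14 * d.+1 * C * rho * n)%N by lia.
  by rewrite leq_mul2r leq_mul2r /m; lia.
have -> : (m * rho * (2 * (a + 2 * j * (a + b) + 2 * y)) =
  2 * (m * rho * a) + 4 * (m * rho * (j * (a + b))) + 4 * (m * rho * y))%N by lia.
lia.
Qed.

(** Both bounds have exponents of order at most [n], but the lower one [q ^ n] carries the factor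
    [log q], which can be taken larger than all the constants. This is decisive when [k = d]. *)
Lemma folner_dominates_Zpow d k : (0 < d)%N -> (k <= d)%N ->
  folner_dominates (Shuffler (Zpow d)) (wreath Zmod2 (Zpow k)).
Proof.
case: d => // d _ kd; pose i : 'I_d.+1 := ord0; pose h := unitvec i.
exists (transp_of 1 h |` [fset shift_of (unitvec i) | i in 'I_d.+1]) => T K C.
have [U TU] := folner_wreath T.
have [c c0 cP] := Zpow_folner [fset p.2 | p in T].
pose m := (14 * d.+1 * C + K).+1.
(* Then [rho = 16 * 2 ^ L], so [16 * n] is exactly the cardinality of the box, and
   [q ^ n = 2 ^ (L.+1 * n)] exceeds [K * #|B|]. *)
pose L := (16 * (U * (c * m) ^ k) + K)%N.
pose q := (2 ^ L.+1)%N.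
have q0 : (0 < q)%N by rewrite expn_gt0.
pose rho := (8 * q)%N.
have rho0 : (0 < rho)%N by rewrite muln_gt0.
have [F [F0 FT cF]] := cP (m * rho)%N ltac:(by rewrite muln_gt0).
have [B [B0 BT cB]] := TU F _ F0 FT.
exists (m * rho)%N, B; split=> //.
  by apply: (@leq_trans m); [rewrite /m; lia | rewrite leq_pmulr].
move=> A A0 AS.
pose n := (2 ^ L * rho ^ d)%N.
have rE : rho = (16 * 2 ^ L)%N by rewrite /rho /q expnS mulnA.
have nE : (16 * n = rho ^ d.+1)%N by rewrite /n mulnA -rE expnS.
have n0 : (0 < n)%N by rewrite muln_gt0 !expn_gt0 rho0.
apply: (@leq_trans (q ^ n)%N); last first.
  apply: (@Shuffler_Zpow_card _ i) => // x j xB jR.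
  set M := (C * #|` A|)%N in AS.
  have Ah : (m * rho * leak A (transp_of 1 h) <= M)%N by apply: AS; rewrite !inE eqxx.
  have Ab l : (m * rho * leak A (shift_of (unitvec l)) <= M)%N.
    by apply: AS; rewrite !inE; apply/orP; right; apply/imfsetP; exists l.
  have Ax : (m * rho * leak A (shift_of x) <= d.+1 * rho * M)%N.
    apply: (@leq_trans (l1norm x * M)%N).
      apply: (@subadditive_l1norm _ (fun v => m * rho * leak A (shift_of v))%N).
      - by rewrite [shift_of 1](_ : _ = 1) ?leak1 ?muln0.
      - move=> v w; rewrite -mulnDr leq_mul2l; apply/orP; right.
        have -> : shift_of (v * w) = shift_of v * shift_of w by rewrite mul_shift_of.
        exact: leakM.
      - move=> v; rewrite leq_mul2l; apply/orP; right.
        have -> : shift_of v^-1 = (shift_of v)^-1; last exact: leakV.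
        by apply: (mulgI (shift_of v)); rewrite mulgV mul_shift_of /= mulgV.
      - exact: Ab.
    rewrite leq_mul2r; apply/orP; right.
    rewrite /l1norm -[X in (_ <= X * _)%N]card_ord -sum_nat_const.
    by apply: leq_sum => l _; have /in_box/(_ l) := xB; lia.
  have ht : (leak A (transp_of 1 (h ^+ j)) <=
     leak A (transp_of 1 h) + 2 * j.-1 * (leak A (transp_of 1 h) + leak A (shift_of h)))%N.
    case: j jR => // j _; apply: leak_transp_expg => l l0.
    apply: contraTneq l0 => l1; have := unitvec_expg i l.
    by rewrite -/h l1 mxE; case: (l).
  (* The transposition at [x] is the conjugate by [shift_of x] of the one at the identity. *)
  have := leak_transp_move A (shift_of x) 1 (h ^+ j).
  have sE y : move_point (shift_of x) y = x * y by exact: finsym_oneE.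
  rewrite !sE mulg1 => xt.
  have j1 : (j.-1 <= rho)%N by move: jR; rewrite -/rho; lia.
  have step a b y : (m * rho * a <= M -> m * rho * b <= M -> m * rho * y <= d.+1 * rho * M ->
      2 * (a + 2 * j.-1 * (a + b) + 2 * y) <= #|` A|)%N.
    exact: (@leak_arith _ _ _ _ C K).
  apply: leq_trans (step _ _ _ Ah (Ab i) Ax); rewrite leq_mul2l; apply/orP; right.
  by apply: (leq_trans xt); rewrite leq_add2r.
apply: (@leq_trans (2 ^ (K + 16 * (U * (c * m) ^ k) * n))%N).
  rewrite expnD; apply: leq_mul; first exact/ltnW/ltn_expl.
  apply: (leq_trans cB); rewrite leq_pexp2l // cF.
  have -> : (16 * (U * (c * m) ^ k) * n = U * (c * m) ^ k * (16 * n))%N.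
    by rewrite [LHS]mulnAC mulnC.
  by rewrite nE mulnA expnMn mulnA leq_mul2l leq_pexp2l // orbT.
rewrite /q -expnM leq_pexp2l // /L; nia.
Qed.

(** * Regular maps between word metrics *)

Lemma ex_ball (G : groupType) (S : fgenset G) (n : nat) :
  exists B : {fset G}, forall g, (word_length S g <= n)%N -> g \in B.
Proof.
suff [B BP] : exists B : {fset G}, forall w, is_word S w -> (size w <= n)%N ->
    \prod_(x <- w) x \in B.
  by exists B => g gn; have [w [wS wn <-]] := word_length_word S g; apply: BP; rewrite ?wn.
elim: n => [|n [B BP]].
  by exists [fset 1] => -[|//] _ _; rewrite big_nil inE.
pose S' := gens S `|` [fset x^-1 | x in gens S].
exists (1 |` [fset x * b | x in S', b in B]) => -[|x w] /=.
  by rewrite big_nil !inE eqxx.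
move=> /andP[xS wS] wn; rewrite big_cons !inE; apply/orP; right.
apply/imfset2P; exists x; last by exists (\prod_(x <- w) x) => //; apply: BP.
rewrite !inE; case/orP: xS => [->//|xS]; apply/orP; right.
by apply/imfsetP; exists x^-1 => //; rewrite invgK.
Qed.

Lemma card_le_count (T U : choiceType) (f : T -> U) (A : {fset T}) y m :
  ([set x | f x = y]%classic #<= `I_m)%card -> (count (fun x => f x == y) A <= m)%N.
Proof.
move=> fm; pose F := [fset x in A | f x == y].
have -> : count (fun x => f x == y) A = #|` F|.
  rewrite -[RHS]count_predT count_fset_filter.
  by apply: eq_count => x; rewrite andbT.
rewrite -card_le_II; apply: card_le_trans fm.
have /card_eq_fsetP/card_esym/card_eqPle[IF _] : #|` F| = #|` F| by [].
apply: card_le_trans IF _; apply: subset_card_le => x /=.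
by rewrite !inE => /andP[_ /eqP].
Qed.

(** By left invariance, [x] and [x * s] are at distance the length of [s], so the displacements of
    [f] stay in one ball, which is finite. *)
Lemma regular_map_lip (R : realType) (X Y : groupType) (S : fgenset X) (T : fgenset Y)
    (f : wordSpace R S -> wordSpace R T) (C : R) :
    (0 < C)%R -> lipschitz_map C f -> forall S0 : {fset X}, exists T0 : {fset Y},
  forall x s : X, s \in S0 -> (f x : Y)^-1 * (f (x * s) : Y) \in T0.
Proof.
move=> C0 fC S0; pose M := \sum_(s <- S0) word_length S s.
have [B BP] := ex_ball T (Num.bound (C * M%:R)%R).
exists B => x s sS0; apply: BP.
pose z : X := x * s.
have := fC x z; rewrite -/z.
have -> : mdist (f x) (f z) = (word_length T ((f x : Y)^-1 * (f z : Y))%g)%:R%R by [].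
have -> : mdist (x : wordSpace R S) z = (word_length S s)%:R%R.
  by rewrite -[in RHS](mulKg x s).
move=> le; rewrite -(ler_nat R); apply: le_trans le _.
apply: (@le_trans _ _ (C * M%:R)%R).
  by rewrite ler_pM2l // ler_nat /M (big_fsetD1 s) //= leq_addr.
by apply/ltW/archi_boundP; rewrite mulr_ge0 // ltW.
Qed.

(** * Iteration and conclusion *)

Lemma amenable_iterShuffler n d : amenable (iterShuffler n (Zpow d)).
Proof.
by elim: n => [|n IH]; [exact: amenable_Zpow | exact: amenable_Shuffler].
Qed.

Lemma iterShuffler_nontrivial n d : (0 < d)%N ->
  exists x : iterShuffler n (Zpow d), x != 1.
Proof.
case: d => // d _; elim: n => [|n [x /Shuffler_nontrivial]]; last exact.
exists (unitvec ord0); apply/negP => /eqP u1.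
by have := unitvec_expg (ord0 : 'I_d.+1) 1; rewrite expg1 u1 mxE.
Qed.

(** The induction starts after one iteration: without any, domination fails for [k = d], since the
    identity map is regular. *)
Lemma folner_dominates_iter n d k : (0 < d)%N -> (k <= d)%N ->
  folner_dominates (iterShuffler n.+1 (Zpow d)) (iterWreath n.+1 k).
Proof.
move=> d0 kd; elim: n => [|n IH]; first exact: folner_dominates_Zpow.
have [x x1] := iterShuffler_nontrivial n.+1 d0.
exact: folner_dominates_step x1 IH.
Qed.

Theorem propositionJ (R : realType) (d k n : nat)
  (hd : (1 <= d)%N) (hk : (1 <= k)%N) (hn : (1 <= n)%N)
  (S : fgenset (iterShuffler n (Zpow d))) (T : fgenset (iterWreath n k)) :
  (exists f : wordSpace R S -> wordSpace R T, regular_map f) -> (d < k)%N.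
Proof.
move=> [f [[C C0 fC] [m _ fm]]]; rewrite ltnNge; apply/negP => kd.
apply: (@folner_dominates_no_regular _ _
  (f : iterShuffler n (Zpow d) -> iterWreath n k) m).
- exact: amenable_iterShuffler.
- by case: n hn S T f fC fm => // n _ *; apply: folner_dominates_iter.
- exact: regular_map_lip C0 fC.
- by move=> y A; apply: card_le_count; apply: fm.
Qed.
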